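(* For every $k\ge 1$, $\mathrm{HCTL}_k$ has the same expressive power as $\mathrm{HCTL}^+_k$: every $\mathrm{HCTL}^+_k$ state formula is equivalent to some $\mathrm{HCTL}_k$ state formula (and every $\mathrm{HCTL}_k$ formula is an $\mathrm{HCTL}^+_k$ formula).
   Context: Models are rooted trees (finite or infinite), edges directed from parents to children, each node labelled with a set of atomic propositions. A path from a node $v$ is a maximal sequence $v=v_0,v_1,\dots$ with $v_{i+1}$ a child of $v_i$. Formulas of $\mathrm{HCTL}^*_k$ (variables $x_1,\dots,x_k$): state formulas $\varphi ::= p \mid \neg\varphi \mid \varphi\lor\varphi \mid \varphi\land\varphi \mid \mathsf{E}\psi \mid \mathsf{A}\psi \mid {\downarrow}x_i\,\varphi \mid x_i \mid @_{x_i}\varphi \mid \mathit{root} \mid @_{\mathit{root}}\varphi$; path formulas $\psi ::= \varphi \mid \neg\psi \mid \psi\lor\psi\mid\psi\land\psi\mid \mathsf{X}\psi \mid \psi\,\mathsf{U}\,\psi$. State formulas are evaluated at a tree $T$, node $v$, assignment $\vec u=(u_1,\dots,u_k)$ of nodes: $p$ holds if $p$ labels $v$; $\mathsf{E}\psi$ (resp. $\mathsf{A}\psi$) holds if some (resp. every) path $\pi$ from $v$ satisfies $\psi$ at position 0; ${\downarrow}x_i\varphi$ holds if $\varphi$ holds at $v$ under $\vec u$ with $u_i$ replaced by $v$; $x_i$ holds iff $v=u_i$; $@_{x_i}\varphi$ holds iff $\varphi$ holds at $u_i$; $\mathit{root}$ holds iff $v$ is the root; $@_{\mathit{root}}\varphi$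 holds iff $\varphi$ holds at the root. Path formulas at a path $\pi$, position $i$: a state formula holds if it holds at $\pi(i)$; $\mathsf{X}\psi$ holds if $\psi$ holds at $i+1$; $\psi_1\mathsf{U}\psi_2$ holds if there is $j\ge i$ with $\psi_2$ at $j$ and $\psi_1$ at all $l$, $i\le l<j$; Booleans as usual. $\mathrm{HCTL}_k$: path formulas restricted to $\mathsf{X}\varphi$ and $\varphi_1\mathsf{U}\varphi_2$ with state formulas $\varphi,\varphi_1,\varphi_2$. $\mathrm{HCTL}^+_k$: path formulas restricted to Boolean combinations of formulas $\mathsf{X}\varphi$ and $\varphi_1\mathsf{U}\varphi_2$ with state formulas $\varphi,\varphi_1,\varphi_2$. Two state formulas are equivalent if they hold at exactly the same (tree, node, assignment) triples. *)

(* Defs.v *)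
From mathcomp Require Import all_boot.

Set Implicit Arguments.
Unset Strict Implicit.
Unset Printing Implicit Defensive.

(* No bound is put on the branching or on the cardinality of the tree.        *)
(* The last three fields together exclude cycles and force a unique finite    *)
(* path from the root to each node.                                           *)
Inductive reachable (N : Type) (child : N -> N -> Prop) (r : N) : N -> Prop :=
| reachable_refl : reachable child r r
| reachable_step v w : reachable child r v -> child v w -> reachable child r w.

Record ltree (AP : Type) : Type := LTree {
  node :> Type;
  troot : node;
  child : node -> node -> Prop;   (* [child v w]: w is a child of v *)
  label : node -> AP -> Prop;
  troot_no_parent : forall v, ~ child v troot;
  parent_unique : forall v v' w, child v w -> child v' w -> v = v';
  troot_reachable : forall v, reachable child troot v
}.
Arguments troot {AP} l.

(* A finite or infinite sequence of nodes is a function to [option node] that *)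
(* is [None] exactly beyond the end of the sequence; it is maximal when it    *)
(* only ends at a leaf.                                                       *)
Definition is_path (AP : Type) (T : ltree AP) (v : T) (pi : nat -> option T)
    : Prop :=
  pi 0 = Some v /\
  forall i, match pi i, pi i.+1 with
            | Some a, Some b => child a b
            | Some a, None => forall b, ~ child a b
            | None, Some _ => False
            | None, None => True
            end.

Inductive sform (AP : Type) (k : nat) : Type :=
| SAtom of AP
| SNot of sform AP k
| SOr of sform AP k & sform AP k
| SAnd of sform AP k & sform AP k
| SE of pform AP k
| SA of pform AP k
| SDown of 'I_k & sform AP k
| SVar of 'I_k
| SAt of 'I_k & sform AP k
| SRoot
| SAtRoot of sform AP k
with pform (AP : Type) (k : nat) : Type :=
| PState of sform AP k
| PNot of pform AP k
| POr of pform AP k & pform AP k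
| PAnd of pform AP k & pform AP k
| PX of pform AP k
| PU of pform AP k & pform AP k.
Arguments SRoot {AP k}.

Definition update (k : nat) (N : Type) (u : 'I_k -> N) (i : 'I_k) (v : N)
    : 'I_k -> N :=
  fun j => if j == i then v else u j.

(* [psat] is meaningful only at positions inside the path; X and U explicitly *)
(* require the positions they move to to exist, so on a finite path X fails   *)
(* at the last position.                                                      *)
Fixpoint ssat (AP : Type) (k : nat) (T : ltree AP) (phi : sform AP k)
    (v : T) (u : 'I_k -> T) {struct phi} : Prop :=
  match phi with
  | SAtom p => label v p
  | SNot a => ~ ssat a v u
  | SOr a b => ssat a v u \/ ssat b v u
  | SAnd a b => ssat a v u /\ ssat b v u
  | SE psi => exists pi, is_path v pi /\ psat psi pi 0 u
  | SA psi => forall pi, is_path v pi -> psat psi pi 0 u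
  | SDown i a => ssat a v (update u i v)
  | SVar i => v = u i
  | SAt i a => ssat a (u i) u
  | SRoot => v = troot T
  | SAtRoot a => ssat a (troot T) u
  end
with psat (AP : Type) (k : nat) (T : ltree AP) (psi : pform AP k)
    (pi : nat -> option T) (i : nat) (u : 'I_k -> T) {struct psi} : Prop :=
  match psi with
  | PState phi => match pi i with Some v => ssat phi v u | None => False end
  | PNot a => ~ psat a pi i u
  | POr a b => psat a pi i u \/ psat b pi i u
  | PAnd a b => psat a pi i u /\ psat b pi i u
  | PX a => isSome (pi i.+1) /\ psat a pi i.+1 u
  | PU a b => exists j, [/\ i <= j, isSome (pi j), psat b pi j u &
                            forall l, i <= l -> l < j -> psat a pi l u]
  end.

Definition sequiv (AP : Type) (k : nat) (phi phi' : sform AP k) : Prop :=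
  forall (T : ltree AP) (v : T) (u : 'I_k -> T), ssat phi v u <-> ssat phi' v u.

Fixpoint is_hctl (AP : Type) (k : nat) (phi : sform AP k) : bool :=
  match phi with
  | SAtom _ | SVar _ | SRoot => true
  | SNot a | SDown _ a | SAt _ a | SAtRoot a => is_hctl a
  | SOr a b | SAnd a b => is_hctl a && is_hctl b
  | SE psi | SA psi => is_hctl_path psi
  end
with is_hctl_path (AP : Type) (k : nat) (psi : pform AP k) : bool :=
  match psi with
  | PX (PState a) => is_hctl a
  | PU (PState a) (PState b) => is_hctl a && is_hctl b
  | _ => false
  end.

Fixpoint is_hctl_plus (AP : Type) (k : nat) (phi : sform AP k) : bool :=
  match phi with
  | SAtom _ | SVar _ | SRoot => true
  | SNot a | SDown _ a | SAt _ a | SAtRoot a => is_hctl_plus a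
  | SOr a b | SAnd a b => is_hctl_plus a && is_hctl_plus b
  | SE psi | SA psi => is_hctl_plus_path psi
  end
with is_hctl_plus_path (AP : Type) (k : nat) (psi : pform AP k) : bool :=
  match psi with
  | PX (PState a) => is_hctl_plus a
  | PU (PState a) (PState b) => is_hctl_plus a && is_hctl_plus b
  | PNot a => is_hctl_plus_path a
  | POr a b | PAnd a b => is_hctl_plus_path a && is_hctl_plus_path b
  | _ => false
  end.

(* Main.v *)
(* After Emerson and Halpern. A path formula is decided at a path of length    *)
(* one by a state formula. On any other path, the expansions                  *)
(*   a U b = b \/ (a /\ X (a U b)),                                           *)
(*   ~ (a U b) = G ~b \/ (~b U (~a /\ ~b))                                    *)
(* put it in disjunctive normal form, with clauses                            *)
(*   a /\ X (/\_i (b_i U c_i) /\ G g).                                        *)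
(* E of such a clause is a /\ EX E (/\_i (b_i U c_i) /\ G g), and a path       *)
(* satisfying /\_i (b_i U c_i) /\ G g satisfies all b_i and g until the first  *)
(* c_i to be fulfilled, whence E of the conjunction is                        *)
(*   \/_i E [(/\_j b_j /\ g) U (c_i /\ E (/\_(j != i) (b_j U c_j) /\ G g))]. *)
Require Import Defs.
From mathcomp Require Import all_boot.
From Stdlib Require Import Classical.

Set Implicit Arguments.
Unset Strict Implicit.
Unset Printing Implicit Defensive.

(* Only path quantifiers need work, and [A psi] is [~ E ~psi]; so it suffices to express [E psi] for
   a Boolean combination [psi] of X and U over translated state formulas. At a leaf the only path is
   the node itself and [psi] collapses to a state formula ([leaf_definable]). At any other node
   every path has a second position, so X commutes with negation and unfolding the untils once gives
   a disjunctive normal form ([dnf_definable]). [SE_hctl] joins the two cases.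

   E distributes over the disjunction ([SE_dnf]), which leaves single clauses ([SE_clause]). Their
   core is [ssat_SE_untils]: guess which pending until is fulfilled first, walk to that position by
   one HCTL until, and recurse with one obligation fewer. The paths of the successive stages are
   glued together, which is sound because truth depends only on the rest of the path ([psat_shift]).
   The construction adds no binder, so [k] is unchanged. *)
Scheme sform_pform_ind := Induction for sform Sort Prop
  with pform_sform_ind := Induction for pform Sort Prop.
Combined Scheme form_ind from sform_pform_ind, pform_sform_ind.

(** * Finite conjunctions and disjunctions, earliest witnesses *)

Lemma foldr_and_nth (X : Type) (P : X -> Prop) (d : X) (s : seq X) :
  foldr (fun x Q => P x /\ Q) True s <->
  forall i, i < size s -> P (nth d s i).
Proof.
elim: s => [|x s IHs] /=; first by split.
split=> [[Px /IHs Ps] [|i] //= /Ps //|Ps].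
by split; [exact: (Ps 0)|apply/IHs => i; exact: (Ps i.+1)].
Qed.

Lemma foldr_and_cat (X : Type) (P : X -> Prop) (s t : seq X) :
  foldr (fun x Q => P x /\ Q) True (s ++ t) <->
  foldr (fun x Q => P x /\ Q) True s /\ foldr (fun x Q => P x /\ Q) True t.
Proof. by elim: s => [|x s IHs] /=; tauto. Qed.

Lemma foldr_or_cat (X : Type) (P : X -> Prop) (s t : seq X) :
  foldr (fun x Q => P x \/ Q) False (s ++ t) <->
  foldr (fun x Q => P x \/ Q) False s \/ foldr (fun x Q => P x \/ Q) False t.
Proof. by elim: s => [|x s IHs] /=; tauto. Qed.

(** Fix one witness per index and take the least of these: no witness need be minimal for its own
    index. The induction compares the new witness with the least so far. *)
Lemma ex_first_witness (W : nat -> nat -> Prop) (I : seq nat) :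
  I <> [::] -> (forall i, i \in I -> exists j, W i j) ->
  exists i j, [/\ i \in I, W i j &
    forall i', i' \in I -> exists2 j', j <= j' & W i' j'].
Proof.
elim: I => [//|i I IHI] _ HW.
have [j Wij] := HW i (mem_head _ _).
case: (I =P [::]) => [I0|/IHI].
  exists i, j; split=> //; first exact: mem_head.
  by move=> i'; rewrite I0 inE => /eqP ->; exists j.
case=> [i' I'|i0 [j0 [I_i0 W0 min0]]]; first by apply: HW; rewrite inE I' orbT.
have [le_j|/ltnW le_j] := leqP j j0.
  exists i, j; split=> //; first exact: mem_head.
  move=> i'; rewrite inE => /predU1P[->|/min0[j' le_j']]; first by exists j.
  by exists j' => //; apply: leq_trans le_j'.
exists i0, j0; split=> //; first by rewrite inE I_i0 orbT.
by move=> i'; rewrite inE => /predU1P[->|/min0 //]; exists j.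
Qed.

(** * Suffixes and gluing of paths *)

Section Paths.
Variables (AP : Type) (T : ltree AP).
Implicit Types (v w : T) (pi rho : nat -> option T).

Definition suffix pi n := fun i => pi (n + i).

(** Position [n] is already taken from [rho]; the two sequences agree there when [rho] starts at the
    node [pi n]. *)
Definition glue pi n rho := fun i => if i < n then pi i else rho (i - n).

Lemma is_path_suffix v w pi n :
  is_path v pi -> pi n = Some w -> is_path w (suffix pi n).
Proof.
move=> [_ Hpi] pin; split=> [|i]; rewrite /suffix ?addn0 // addnS; apply: Hpi.
Qed.

Lemma is_path_Some v pi i j : is_path v pi -> i <= j -> pi j -> pi i.
Proof.
move=> [_ Hpi]; elim: j => [|j IHj]; first by rewrite leqn0 => /eqP ->.
rewrite leq_eqVlt => /predU1P[-> //|le_ij] pij; apply: IHj => //.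
by move: (Hpi j) pij; case: (pi j) => //; case: (pi j.+1).
Qed.

Lemma glue_ge pi n rho i : glue pi n rho (n + i) = rho i.
Proof. by rewrite /glue ltnNge leq_addr /= addKn. Qed.

Lemma glue_le v w pi n rho i :
    is_path v pi -> pi n = Some w -> is_path w rho -> i <= n ->
  glue pi n rho i = pi i.
Proof.
move=> Hpi pin [rho0 _]; rewrite /glue leq_eqVlt => /predU1P[->|-> //].
by rewrite ltnn subnn rho0 pin.
Qed.

Lemma is_path_glue v w pi n rho :
    is_path v pi -> pi n = Some w -> is_path w rho ->
  is_path v (glue pi n rho).
Proof.
move=> Hpi pin Hrho; split=> [|i].
  by rewrite (glue_le Hpi pin Hrho) //; case: Hpi.
have [lt_in|le_ni] := ltnP i n.
  by rewrite !(glue_le Hpi pin Hrho) ?(ltnW lt_in) //; apply: (Hpi.2).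
by rewrite -(subnKC le_ni) -addnS !glue_ge; apply: (Hrho.2).
Qed.

End Paths.

(** * Semantics of the derived temporal operators *)

Section Translation.
Variables (AP : Type) (k : nat).
Implicit Types (a b c g phi : sform AP k) (psi : pform AP k).
Implicit Types (us : seq (sform AP k * sform AP k)).

(** The grammar has no constants and [AP] may be empty, hence a contradiction built on [root]. *)
Definition SFalse : sform AP k := SAnd SRoot (SNot SRoot).
Definition STrue : sform AP k := SNot SFalse.
Definition Until a b : pform AP k := PU (PState a) (PState b).
Definition Next a : pform AP k := PX (PState a).
Definition Always c : pform AP k := PNot (Until STrue (SNot c)).

Lemma ssat_SFalse (T : ltree AP) (v : T) u : ssat SFalse v u <-> False.
Proof. by split=> // -[]. Qed.

Lemma ssat_STrue (T : ltree AP) (v : T) u : ssat STrue v u.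
Proof. by case. Qed.

Lemma ssat_SE (T : ltree AP) psi (v : T) u :
  ssat (SE psi) v u <-> exists2 pi, is_path v pi & psat psi pi 0 u.
Proof. by split=> [[pi []]|[pi]]; exists pi. Qed.

Lemma ssat_SAnd (T : ltree AP) a b (v : T) u :
  ssat (SAnd a b) v u <-> ssat a v u /\ ssat b v u.
Proof. by []. Qed.

Lemma psat_PState (T : ltree AP) a (pi : nat -> option T) i u :
  psat (PState a) pi i u <-> exists2 w, pi i = Some w & ssat a w u.
Proof.
rewrite /=; case: (pi i) => [w|]; split=> //; first by exists w.
  by case=> x [->].
by case.
Qed.

(** Path operators look only forward and state formulas see only the current node, so positions
    before [n] have no influence. *)
Lemma psat_shift (T : ltree AP) psi (pi rho : nat -> option T) n i u :
  (forall j, pi (n + j) = rho j) ->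
  psat psi pi (n + i) u <-> psat psi rho i u.
Proof.
move=> pi_rho; elim: psi i => [a|p IHp|p IHp q IHq|p IHp q IHq|p IHp|p IHp q IHq]
  i /=; rewrite -?addnS ?pi_rho ?IHp ?IHq //.
split=> [[j [le_j pij qj pl]]|[j [le_j pij qj pl]]].
  have le_nj : n <= j by apply: leq_trans le_j; apply: leq_addr.
  exists (j - n); split; first by rewrite leq_subRL.
  - by rewrite -pi_rho subnKC.
  - by apply/IHq; rewrite subnKC.
  - by move=> l le_l lt_l; apply/IHp; apply: pl; rewrite ?leq_add2l -?ltn_subRL.
exists (n + j); split; rewrite ?leq_add2l ?pi_rho //; first exact/IHq.
move=> l le_l lt_l.
have le_nl : n <= l by apply: leq_trans le_l; apply: leq_addr.
rewrite -(subnKC le_nl); apply/IHp; apply: pl; first by rewrite leq_subRL.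
by rewrite ltn_subLR.
Qed.

Lemma psat_Until (T : ltree AP) a b (pi : nat -> option T) i u :
  psat (Until a b) pi i u <->
  exists j, [/\ i <= j, psat (PState b) pi j u &
                forall l, i <= l -> l < j -> psat (PState a) pi l u].
Proof.
split=> [[j [le_ij _ bj al]]|[j [le_ij bj al]]]; exists j; split=> //.
by move: bj => /=; case: (pi j).
Qed.

Lemma psat_Until_prefix (T : ltree AP) a b (pi : nat -> option T) i j u :
    i <= j -> psat (Until a b) pi j u ->
    (forall l, i <= l -> l < j -> psat (PState a) pi l u) ->
  psat (Until a b) pi i u.
Proof.
move=> le_ij /psat_Until[m [le_jm bm am]] al; apply/psat_Until.
exists m; split=> // [|l le_il lt_lm]; first exact: leq_trans le_jm.
by case: (ltnP l j) => [/al|/am]; apply.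
Qed.

Lemma psat_Until1 (T : ltree AP) a b (pi : nat -> option T) i u :
  psat (Until a b) pi i u <->
  psat (PState b) pi i u \/
  psat (PState a) pi i u /\ psat (Until a b) pi i.+1 u.
Proof.
rewrite !psat_Until; split=> [[j [le_ij bj al]]|[bi|[ai [j [lt_ij bj al]]]]].
- move: le_ij; rewrite leq_eqVlt => /predU1P[->|lt_ij]; first by left.
  right; split; first exact: al.
  by exists j; split=> // l /ltnW; apply: al.
- by exists i; split=> // l le_il; rewrite ltnNge le_il.
- exists j; split=> //; first exact: ltnW.
  by move=> l; rewrite leq_eqVlt => /predU1P[<- //|]; apply: al.
Qed.

(** Even [STrue] fails beyond the end of a path. Turning a violation of [c] into a true until thus
    needs all earlier positions to exist, which [is_path] provides. *)
Lemma psat_Always (T : ltree AP) c (v : T) (pi : nat -> option T) i u :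
    is_path v pi ->
  psat (Always c) pi i u <->
  forall j w, i <= j -> pi j = Some w -> ssat c w u.
Proof.
move=> Hpi; split=> [H j w le_ij pij|H]; last first.
  case=> j [le_ij _]; rewrite /=; case Epi: (pi j) => [w|] // nc _.
  by apply: nc; apply: H Epi.
apply: NNPP => nc; apply: H; apply: (iffRL (psat_Until STrue (SNot c) pi i u)); exists j.
split; rewrite //= ?pij // => l _ /ltnW le_lj.
have : pi l by apply: is_path_Some Hpi le_lj _; rewrite pij.
by case: (pi l) => // x _ [].
Qed.

Fixpoint sands (s : seq (sform AP k)) : sform AP k :=
  if s is a :: s' then SAnd a (sands s') else STrue.

Fixpoint sors (s : seq (sform AP k)) : sform AP k :=
  if s is a :: s' then SOr a (sors s') else SFalse.

Lemma ssat_sands_map (T : ltree AP) (f : nat -> sform AP k) I (v : T) u :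
  ssat (sands (map f I)) v u <-> forall i, i \in I -> ssat (f i) v u.
Proof.
elim: I => [|i I IHI] /=; first by split=> // _ [].
rewrite IHI; split=> [[fi fI] j|fI].
  by rewrite inE => /predU1P[-> //|]; apply: fI.
by split=> [|j Ij]; apply: fI; rewrite inE ?eqxx // Ij orbT.
Qed.

Lemma ssat_sors_map (T : ltree AP) (f : nat -> sform AP k) I (v : T) u :
  ssat (sors (map f I)) v u <-> exists2 i, i \in I & ssat (f i) v u.
Proof.
elim: I => [|i I IHI] /=; first by split=> [[]|[]].
rewrite IHI; split=> [[fi|[j Ij fj]]|[j]].
- by exists i; rewrite ?mem_head.
- by exists j => //; rewrite inE Ij orbT.
- by rewrite inE => /predU1P[-> fi|Ij fj]; [left|right; exists j].
Qed.

Lemma is_hctl_sands_map (f : nat -> sform AP k) I :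
  (forall i, i \in I -> is_hctl (f i)) -> is_hctl (sands (map f I)).
Proof.
elim: I => //= i I IHI fI; rewrite fI ?mem_head //= IHI // => j Ij.
by rewrite fI // inE Ij orbT.
Qed.

Lemma is_hctl_sors_map (f : nat -> sform AP k) I :
  (forall i, i \in I -> is_hctl (f i)) -> is_hctl (sors (map f I)).
Proof.
elim: I => //= i I IHI fI; rewrite fI ?mem_head //= IHI // => j Ij.
by rewrite fI // inE Ij orbT.
Qed.

(** * E of a conjunction of untils and one G *)

Section Untils.
Variables (ab : nat -> sform AP k * sform AP k) (g : sform AP k).

(* Meaningful only for [n = size I].                                          *)
Fixpoint SE_untils n (I : seq nat) : sform AP k :=
  if n is n'.+1 then
    sors [seq SE (Until (SAnd (sands [seq (ab j).1 | j <- I]) g)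
                        (SAnd (ab i).2 (SE_untils n' (rem i I)))) | i <- I]
  else SNot (SA (Until STrue (SNot g))).

Lemma is_hctl_SE_untils n I :
    is_hctl g -> (forall i, i \in I -> is_hctl (ab i).1 && is_hctl (ab i).2) ->
  is_hctl (SE_untils n I).
Proof.
move=> g_hctl; elim: n I => [|n IHn] I abI /=; first by rewrite g_hctl.
apply: is_hctl_sors_map => i Ii /=; rewrite g_hctl.
rewrite is_hctl_sands_map => [|j /abI/andP[]//] /=.
have /andP[_ ->] := abI i Ii; rewrite IHn // => j /mem_rem; exact: abI.
Qed.

(** Induction on the number of pending untils. From left to right, the path to the first fulfilment
    is glued to a path for the remaining untils; from right to left, a path is cut at the earliest
    of the chosen fulfilments. With no until left, [E G g] is written [~ A (true U ~g)], which is in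
    HCTL. *)
Lemma ssat_SE_untils n I (T : ltree AP) (v : T) u :
    size I = n ->
  ssat (SE_untils n I) v u <->
  exists pi, [/\ is_path v pi,
    forall i, i \in I -> psat (Until (ab i).1 (ab i).2) pi 0 u &
    psat (Always g) pi 0 u].
Proof.
elim: n I v => [|n IHn] I v sizeI.
  rewrite (size0nil sizeI) /=; split=> [nA|[pi [Hpi _ nU]] /(_ pi Hpi)//].
  have [pi npi] := not_all_ex_not _ _ nA.
  have [Hpi nU] := imply_to_and _ _ npi.
  by exists pi; split.
rewrite ssat_sors_map; split=> [[i Ii]|[pi []]].
  rewrite ssat_SE => -[pi Hpi]; rewrite psat_Until => -[j [_]].
  rewrite psat_PState => -[w pij]; rewrite ssat_SAnd => -[bw].
  rewrite IHn ?size_rem ?sizeI // => -[rho [Hrho Urho Grho]] al.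
  (* Before [j] all left arguments and [g] hold, so any until true at [j] extends back to position
     0. *)
  have al' l : l < j -> exists2 x, glue pi j rho l = Some x &
      (forall i', i' \in I -> ssat (ab i').1 x u) /\ ssat g x u.
    move=> lt_lj; have := al l isT lt_lj.
    rewrite (glue_le Hpi pij Hrho) ?(ltnW lt_lj) // psat_PState.
    move=> [x pil]; rewrite ssat_SAnd ssat_sands_map => alx.
    by exists x.
  have shift p : psat p (glue pi j rho) j u <-> psat p rho 0 u.
    by rewrite -{2}(addn0 j); apply: psat_shift => m; rewrite glue_ge.
  have Hglue := is_path_glue Hpi pij Hrho.
  exists (glue pi j rho); split=> // [i' Ii'|].
    apply: (@psat_Until_prefix _ _ _ _ 0 j) => // [|l _ lt_lj]; last first.
      by rewrite psat_PState; have [x -> [/(_ _ Ii')]] := al' l lt_lj; exists x.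
    (* The until [i] is fulfilled at [w] itself; every other one is inherited from [rho]. *)
    rewrite shift; case: (i' =P i) => [->|/eqP ne_i'i].
      rewrite psat_Until1 psat_PState; left; exists w => //; exact: Hrho.1.
    apply: Urho; move: Ii'; rewrite (perm_mem (perm_to_rem Ii)).
    by rewrite inE (negPf ne_i'i).
  rewrite (psat_Always _ _ _ Hglue) => m x _ gm.
  case: (ltnP m j) => [/al'[y] | le_jm]; first by rewrite gm => -[<-] [].
  move: gm; rewrite -(subnKC le_jm) glue_ge.
  move: Grho; rewrite (psat_Always _ _ _ Hrho); exact.
move=> Hpi Upi Gpi.
(* A witness records the left argument on all earlier positions too; so a witness at or after [j]
   guarantees that argument throughout the stretch before [j]. *)
have [|i Ii|i [j [Ii [bj aj] first_j]]] := @ex_first_witness (fun i j =>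
  psat (PState (ab i).2) pi j u /\
  forall l, l < j -> psat (PState (ab i).1) pi l u) I.
- by move=> I0; rewrite I0 in sizeI.
- have := Upi i Ii; rewrite psat_Until => -[j [_ bj aj]].
  by exists j; split=> // l; apply: aj.
have a_before i' l : i' \in I -> l < j -> psat (PState (ab i').1) pi l u.
  by move=> /first_j[j' le_jj' [_ aj']] lt_lj; apply: aj'; apply: leq_trans le_jj'.
move: Gpi; rewrite (psat_Always _ _ _ Hpi) => Gpi.
exists i; rewrite // ssat_SE; exists pi; rewrite // psat_Until.
move: bj; rewrite psat_PState => -[w pij bw]; exists j; split=> // [|l _ lt_lj].
  rewrite psat_PState; exists w; rewrite // ssat_SAnd; split=> //.
  have Hsuf := is_path_suffix Hpi pij.
  rewrite IHn ?size_rem ?sizeI //; exists (suffix pi j); split=> // [i'|].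
    move=> /mem_rem/first_j[j' le_jj' [bj' aj']].
    rewrite -(@psat_shift _ _ pi _ j) // addn0 psat_Until.
    by exists j'; split=> // l _; apply: aj'.
  rewrite (psat_Always _ _ _ Hsuf) => m x _; exact: Gpi.
have := a_before i l Ii lt_lj; rewrite !psat_PState => -[x pil _].
exists x; rewrite // ssat_SAnd ssat_sands_map; split; last exact: Gpi pil.
move=> i' Ii'; have := a_before i' l Ii' lt_lj.
by rewrite psat_PState pil => -[y [<-]].
Qed.
End Untils.

(** * Negated untils, and E of a disjunctive normal form *)

Lemma psat_not_Until (T : ltree AP) a b (v : T) (pi : nat -> option T) i u :
    is_path v pi ->
  ~ psat (Until a b) pi i u <->
  psat (Always (SNot b)) pi i u \/
  psat (Until (SNot b) (SAnd (SNot a) (SNot b))) pi i u.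
Proof.
move=> Hpi; rewrite (psat_Always _ _ _ Hpi) !psat_Until; split=> [nU|].
  apply: NNPP => /not_or_and[nA nU']; apply: nA => j w.
  have [n] := ubnP j; elim: n j w => // n IHn j w lt_jn le_ij pij bw.
  have nb l x : i <= l -> l < j -> pi l = Some x -> ~ ssat b x u.
    by move=> le_il lt_lj; apply: (IHn l x) => //; exact: leq_trans lt_lj lt_jn.
  apply: nU; exists j; split=> // [|l le_il lt_lj].
    by rewrite psat_PState; exists w.
  have : pi l by apply: is_path_Some Hpi (ltnW lt_lj) _; rewrite pij.
  case pil: (pi l) => [x|] // _; rewrite psat_PState; exists x => //.
  apply: NNPP => nax; apply: nU'; exists l; split=> // [|m le_im lt_ml].
    rewrite psat_PState; exists x; rewrite // ssat_SAnd; split=> //.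
    exact: nb pil.
  have : pi m by apply: is_path_Some Hpi (ltnW lt_ml) _; rewrite pil.
  case pim: (pi m) => [y|] // _; rewrite psat_PState; exists y => //.
  by apply: nb pim => //; apply: ltn_trans lt_lj.
move=> H [j [le_ij bj aj]].
move: bj; rewrite psat_PState => -[w pij bw].
case: H => [/(_ j w le_ij pij)//|[l [le_il abl bl]]].
case: (ltnP l j) => [lt_lj|le_jl].
  have := aj l le_il lt_lj; move: abl; rewrite !psat_PState.
  by case=> x ->; rewrite ssat_SAnd => -[nax _] [y [<-]].
move: le_jl; rewrite leq_eqVlt => /predU1P[jl|/(bl j le_ij)].
  move: abl; rewrite -jl psat_PState pij => -[x [<-]].
  by rewrite ssat_SAnd => -[_].
by rewrite psat_PState pij => -[x [<-]].
Qed.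

(* A clause [(a, us, g)] stands for the path formula                          *)
(* [a /\ X (/\_((b, c) in us) b U c /\ G g]].                                 *)
Definition clause : Type :=
  sform AP k * seq (sform AP k * sform AP k) * sform AP k.

(** X is rendered as evaluation at position 1, whose existence is required separately. *)
Definition clause_sat (c : clause) (T : ltree AP) (pi : nat -> option T) u :=
  let: (a, us, g) := c in
  [/\ psat (PState a) pi 0 u,
      foldr (fun ab Q => psat (Until ab.1 ab.2) pi 1 u /\ Q) True us &
      psat (Always g) pi 1 u].

Definition clause_hctl (c : clause) : bool :=
  let: (a, us, g) := c in
  [&& is_hctl a, all (fun ab => is_hctl ab.1 && is_hctl ab.2) us & is_hctl g].

Lemma SE_clause (c : clause) : clause_hctl c ->
  exists2 phi, is_hctl phi & forall (T : ltree AP) (v : T) u, ssat phi v u <->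
    exists pi, [/\ is_path v pi, isSome (pi 1) & clause_sat c pi u].
Proof.
case: c => [[a us] g] /and3P[a_hctl us_hctl g_hctl].
pose d := (STrue, STrue).
(* Formulas over an arbitrary [AP] have no decidable equality, so membership and [rem] act on
   indices; [d] is never read, all indices being below [n]. *)
pose n := size us; pose psi := SE_untils (nth d us) g n (iota 0 n).
have size_n : size (iota 0 n) = n by rewrite size_iota.
exists (SAnd a (SE (Next psi))) => [|T v u].
  rewrite /= a_hctl is_hctl_SE_untils // => i; rewrite mem_iota => lt_in.
  exact: (all_nthP d us_hctl).
rewrite ssat_SAnd ssat_SE; split=> [[av [pi Hpi]]|[pi [Hpi]]].
  case=> _ psi1; move: psi1; change (psat (PState psi) pi 1 u -> exists pi,
    [/\ is_path v pi, isSome (pi 1) & clause_sat (a, us, g) pi u]).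
  rewrite psat_PState => -[w pi1]; rewrite ssat_SE_untils //.
  move=> [rho [Hrho Urho Grho]].
  have Hglue := is_path_glue Hpi pi1 Hrho.
  have shift p : psat p (glue pi 1 rho) 1 u <-> psat p rho 0 u.
    by rewrite -{2}(addn0 1); apply: psat_shift => m; rewrite glue_ge.
  exists (glue pi 1 rho); split=> //.
    by rewrite (glue_le Hpi pi1 Hrho) ?pi1.
  split; last by rewrite shift.
    rewrite psat_PState; exists v => //; exact: Hglue.1.
  apply/(foldr_and_nth _ d) => i lt_in.
  by rewrite shift; apply: Urho; rewrite mem_iota.
case pi1: (pi 1) => [w|] // _ [a0 us1 g1]; split.
  by move: a0; rewrite psat_PState Hpi.1 => -[x [->]].
exists pi => //; split; first by rewrite pi1.
rewrite -/(psat (PState psi) pi 1 u) psat_PState; exists w => //.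
have shift p : psat p pi 1 u <-> psat p (suffix pi 1) 0 u.
  by rewrite -{1}(addn0 1); apply: psat_shift.
rewrite ssat_SE_untils //; exists (suffix pi 1); split.
- exact: is_path_suffix Hpi pi1.
- move=> i; rewrite mem_iota => lt_in; rewrite -shift.
  by move/(foldr_and_nth _ d): us1; apply.
- by rewrite -shift.
Qed.

Definition dnf_sat (cs : seq clause) (T : ltree AP) (pi : nat -> option T) u :=
  foldr (fun (c : clause) Q => clause_sat c pi u \/ Q) False cs.

Lemma SE_dnf (cs : seq clause) : all clause_hctl cs ->
  exists2 phi, is_hctl phi & forall (T : ltree AP) (v : T) u, ssat phi v u <->
    exists pi, [/\ is_path v pi, isSome (pi 1) & dnf_sat cs pi u].
Proof.
elim: cs => [_|c cs IHcs /andP[/SE_clause[a Ha aP] /IHcs[b Hb bP]]].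
  by exists SFalse => // T v u; rewrite ssat_SFalse; split=> // -[pi []].
exists (SOr a b) => [|T v u]; first by rewrite /= Ha.
change (ssat (SOr a b) v u) with (ssat a v u \/ ssat b v u).
rewrite aP bP; split=> [[[pi [? ? ?]]|[pi [? ? ?]]]|[pi [? ? [?|?]]]].
- by exists pi; split=> //; left.
- by exists pi; split=> //; right.
- by left; exists pi.
- by right; exists pi.
Qed.

(** * Paths of length one against longer paths *)

Definition leaf_definable psi : Prop :=
  exists2 l, is_hctl l &
    forall (T : ltree AP) (v : T) pi u, is_path v pi -> pi 1 = None ->
      psat psi pi 0 u <-> ssat l v u.

Definition dnf_definable psi : Prop :=
  exists2 cs, all clause_hctl cs &
    forall (T : ltree AP) (v : T) pi u, is_path v pi -> isSome (pi 1) ->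
      psat psi pi 0 u <-> dnf_sat cs pi u.

(** By maximality a path stops at its first node exactly when that node is a leaf, so [~ EX true]
    tells which of the two descriptions of [psi] applies. *)
Lemma SE_hctl psi : leaf_definable psi -> dnf_definable psi ->
  exists2 phi, is_hctl phi & sequiv (SE psi) phi.
Proof.
move=> [l Hl lP] [cs Hcs csP]; have [d Hd dP] := SE_dnf Hcs.
(* [E (true U true)] asserts that some path leaves the node; dependent choice *)
(* is thereby avoided.                                                        *)
pose leaf := SAnd (SNot (SE (Next STrue))) (SE (Until STrue STrue)).
exists (SOr (SAnd l leaf) d) => [|T v u]; first by rewrite /= Hl.
change (ssat (SOr (SAnd l leaf) d) v u) with
  (ssat l v u /\ ~ ssat (SE (Next STrue)) v u /\
   ssat (SE (Until STrue STrue)) v u \/ ssat d v u).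
rewrite dP !ssat_SE; split=> [[pi Hpi psi0]|[[lv [nX [pi Hpi _]]]|[pi [Hpi pi1 cs0]]]].
- case pi1: (pi 1) => [w|]; last first.
    left; split; first exact/(lP _ _ _ _ Hpi pi1).
    split=> [[rho Hrho [rho1 _]]|].
      (* Since [pi] stops at [v], there is no child for [rho] to move to. *)
      have := Hpi.2 0; rewrite Hpi.1 pi1; have := Hrho.2 0; rewrite Hrho.1.
      by case: (rho 1) rho1 => // x _ vx /(_ x).
    exists pi => //; rewrite psat_Until1 psat_PState; left.
    by exists v; [exact: Hpi.1|exact: ssat_STrue].
  have pi1' : pi 1 by rewrite pi1.
  right; exists pi; split=> //; exact/(csP _ _ _ _ Hpi pi1').
- exists pi => //; apply/(lP _ v) => //; case pi1: (pi 1) => [w|] //.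
  case: nX; exists pi => //; split; first by rewrite pi1.
  rewrite -/(psat (PState STrue) pi 1 u) psat_PState; exists w => //.
  exact: ssat_STrue.
- by exists pi => //; apply/(csP _ _ _ _ Hpi pi1).
Qed.

Lemma dnf_definable_eq p q :
  (forall (T : ltree AP) (v : T) pi u, is_path v pi -> isSome (pi 1) ->
    psat q pi 0 u <-> psat p pi 0 u) ->
  dnf_definable p -> dnf_definable q.
Proof.
move=> pq [cs Hcs csP]; exists cs => // T v pi u Hpi pi1.
by rewrite (pq _ _ _ _ Hpi pi1); apply: csP Hpi pi1.
Qed.

(** * Disjunctive normal forms of connectives and literals *)

Lemma dnf_definable_or p q :
  dnf_definable p -> dnf_definable q -> dnf_definable (POr p q).
Proof.
move=> [cs Hcs csP] [ds Hds dsP]; exists (cs ++ ds) => [|T v pi u Hpi pi1].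
  by rewrite all_cat Hcs.
rewrite /dnf_sat foldr_or_cat -!/(dnf_sat _ _ _) -(csP _ _ _ _ Hpi pi1) -(dsP _ _ _ _ Hpi pi1).
by [].
Qed.

(** Clauses merge into one clause because G commutes with conjunction; this is why a single G per
    clause suffices. *)
Definition clause_and (c d : clause) : clause :=
  let: (a, us, g) := c in let: (b, vs, h) := d in
  (SAnd a b, us ++ vs, SAnd g h).

Lemma clause_hctl_and (c d : clause) :
  clause_hctl c -> clause_hctl d -> clause_hctl (clause_and c d).
Proof.
case: c d => [[a us] g] [[b vs] h] /and3P[Ha Hus Hg] /and3P[Hb Hvs Hh].
by rewrite /= Ha Hb Hg Hh all_cat Hus Hvs.
Qed.

Lemma clause_sat_and (c d : clause) (T : ltree AP) (v : T) pi u : is_path v pi ->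
  clause_sat (clause_and c d) pi u <-> clause_sat c pi u /\ clause_sat d pi u.
Proof.
case: c d => [[a us] g] [[b vs] h] Hpi; rewrite /clause_sat /clause_and.
have and3E (P Q R : Prop) : [/\ P, Q & R] <-> P /\ Q /\ R.
  by split=> [[]|[? []]].
rewrite !and3E foldr_and_cat !psat_PState !(psat_Always _ _ _ Hpi) Hpi.1.
split.
  move=> [[w [<-] [aw bw]] [[Hus Hvs] gh]].
  split; split; try by [exists v]; split=> // j x le_j pij;
    by case: (gh j x le_j pij).
move=> [[[x [<-] ax] [Hus Hg]] [[y [<-] by_] [Hvs Hh]]].
split; first by exists v.
by split=> // j z le_j pij; split; [apply: Hg pij | apply: Hh pij].
Qed.

(** Distributivity; [row] is the case of a single clause on the left. *)
Lemma dnf_sat_and (cs ds : seq clause) (T : ltree AP) (v : T) pi u : is_path v pi ->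
  dnf_sat (allpairs clause_and cs ds) pi u <->
  dnf_sat cs pi u /\ dnf_sat ds pi u.
Proof.
move=> Hpi; have row (c : clause) : dnf_sat (map (clause_and c) ds) pi u <->
    clause_sat c pi u /\ dnf_sat ds pi u.
  elim: ds => [|d ds IHds] /=; first by split=> // -[].
  by rewrite IHds (clause_sat_and _ _ _ Hpi); tauto.
elim: cs => [|c cs IHcs] /=; first by split=> // -[].
by rewrite /dnf_sat foldr_or_cat -!/(dnf_sat _ _ _) row IHcs; tauto.
Qed.

Lemma dnf_definable_and p q :
  dnf_definable p -> dnf_definable q -> dnf_definable (PAnd p q).
Proof.
move=> [cs Hcs csP] [ds Hds dsP].
exists (allpairs clause_and cs ds) => [|T v pi u Hpi pi1].
  elim: cs Hcs {csP} => //= c cs IHcs /andP[Hc /IHcs]; rewrite all_cat => ->.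
  rewrite andbT; elim: ds Hds {dsP IHcs} => //= d ds IHds /andP[Hd /IHds ->].
  by rewrite andbT clause_hctl_and.
rewrite (dnf_sat_and _ _ _ Hpi) -(csP _ _ _ _ Hpi pi1) -(dsP _ _ _ _ Hpi pi1).
by [].
Qed.

Lemma psat_Always_STrue (T : ltree AP) (v : T) pi i u :
  is_path v pi -> psat (Always STrue) pi i u.
Proof.
by move=> Hpi; rewrite (psat_Always _ _ _ Hpi) => j w _ _; apply: ssat_STrue.
Qed.

Lemma psat_STrue (T : ltree AP) (v : T) pi u :
  is_path v pi -> psat (PState STrue) pi 0 u.
Proof.
by move=> Hpi; rewrite psat_PState; exists v; [exact: Hpi.1|exact: ssat_STrue].
Qed.

Lemma dnf_definable_state a : is_hctl a -> dnf_definable (PState a).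
Proof.
move=> Ha; exists [:: (a, [::], STrue)] => [|T v pi u Hpi pi1].
  by rewrite /= Ha.
rewrite /dnf_sat [foldr _ _ _]/=; split=> [a0|[[]|]//].
by left; split=> //; apply: psat_Always_STrue Hpi.
Qed.

Lemma dnf_definable_next_until a b :
  is_hctl a -> is_hctl b -> dnf_definable (PX (Until a b)).
Proof.
move=> Ha Hb; exists [:: (STrue, [:: (a, b)], STrue)] => [|T v pi u Hpi pi1].
  by rewrite /= Ha Hb.
rewrite /dnf_sat [foldr _ _ _]/=; split=> [[_ ab1]|[[_ [ab1 _] _]|]//].
left; split=> //; first exact: psat_STrue Hpi.
exact: psat_Always_STrue Hpi.
Qed.

Lemma dnf_definable_next_always c :
  is_hctl c -> dnf_definable (PX (Always c)).
Proof.
move=> Hc; exists [:: (STrue, [::], c)] => [|T v pi u Hpi pi1].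
  by rewrite /= Hc.
rewrite /dnf_sat [foldr _ _ _]/=; split=> [[_ c1]|[[_ _ c1]|]//].
by left; split=> //; exact: psat_STrue Hpi.
Qed.

(** Under X a clause holds only untils and a G, so [a] is written [false U a], which must be
    fulfilled at once. *)
Lemma dnf_definable_next a : is_hctl a -> dnf_definable (PX (PState a)).
Proof.
move=> Ha; have H : is_hctl SFalse by [].
apply: dnf_definable_eq (dnf_definable_next_until H Ha) => T v pi u Hpi pi1.
suff E : psat (PState a) pi 1 u <-> psat (Until SFalse a) pi 1 u.
  by split=> -[? /E].
rewrite psat_Until1; split=> [|[//|[]]]; first by left.
by rewrite psat_PState => -[w _ /ssat_SFalse].
Qed.

Lemma psat_SNot (T : ltree AP) a (pi : nat -> option T) i u :
  isSome (pi i) -> psat (PState (SNot a)) pi i u <-> ~ psat (PState a) pi i u.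
Proof. by rewrite /=; case: (pi i). Qed.

(** When a second position exists, [~ X a] is [X ~a]. *)
Lemma dnf_definable_not_next a :
  is_hctl a -> dnf_definable (PNot (PX (PState a))).
Proof.
move=> Ha; have H : is_hctl (SNot a) by [].
apply: dnf_definable_eq (dnf_definable_next H) => T v pi u Hpi pi1.
have E := psat_SNot a u pi1.
by split=> [nX|[_ /E na] [_ //]]; split=> //; apply/E => a1; apply: nX.
Qed.

Lemma dnf_definable_until a b :
  is_hctl a -> is_hctl b -> dnf_definable (Until a b).
Proof.
move=> Ha Hb; have Db := dnf_definable_state Hb.
have Da := dnf_definable_state Ha; have DX := dnf_definable_next_until Ha Hb.
apply: dnf_definable_eq (dnf_definable_or Db (dnf_definable_and Da DX)).
move=> T v pi u Hpi pi1; rewrite psat_Until1.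
by split=> [[|[a0 U1]]|[|[a0 [_ U1]]]]; [left|right|left|right].
Qed.

(** Negating [b \/ (a /\ X (a U b))] gives [~b /\ (~a \/ X ~(a U b))], and [psat_not_Until] splits
    the last negation. *)
Lemma dnf_definable_not_until a b :
  is_hctl a -> is_hctl b -> dnf_definable (PNot (Until a b)).
Proof.
move=> Ha Hb.
have Hna : is_hctl (SNot a) by []. have Hnb : is_hctl (SNot b) by [].
have Hn : is_hctl (SAnd (SNot a) (SNot b)) by rewrite /= Ha.
apply: dnf_definable_eq (dnf_definable_and (dnf_definable_state Hnb)
  (dnf_definable_or (dnf_definable_state Hna)
    (dnf_definable_or (dnf_definable_next_always Hnb)
                      (dnf_definable_next_until Hnb Hn)))) => T v pi u Hpi pi1.
have pi0 : isSome (pi 0) by rewrite Hpi.1.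
have Ea := psat_SNot a u pi0; have Eb := psat_SNot b u pi0.
have E1 := psat_not_Until a b 1 u Hpi; have E := psat_Until1 a b pi 0 u.
change (~ psat (Until a b) pi 0 u <->
  psat (PState (SNot b)) pi 0 u /\ (psat (PState (SNot a)) pi 0 u \/
   (isSome (pi 1) /\ psat (Always (SNot b)) pi 1 u \/
    isSome (pi 1) /\ psat (Until (SNot b) (SAnd (SNot a) (SNot b))) pi 1 u))).
rewrite Ea Eb E; move: E1; case: (classic (psat (PState a) pi 0 u)); tauto.
Qed.

(** * Evaluation on paths of length one *)

Lemma leaf_definable_not p : leaf_definable p -> leaf_definable (PNot p).
Proof.
move=> [l Hl lP]; exists (SNot l) => // T v pi u Hpi pi1 /=.
by rewrite (lP _ _ _ _ Hpi pi1).
Qed.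

Lemma leaf_definable_or p q :
  leaf_definable p -> leaf_definable q -> leaf_definable (POr p q).
Proof.
move=> [l Hl lP] [m Hm mP].
exists (SOr l m) => [|T v pi u Hpi pi1] /=; first by rewrite Hl.
by rewrite (lP _ _ _ _ Hpi pi1) (mP _ _ _ _ Hpi pi1).
Qed.

Lemma leaf_definable_and p q :
  leaf_definable p -> leaf_definable q -> leaf_definable (PAnd p q).
Proof.
move=> [l Hl lP] [m Hm mP].
exists (SAnd l m) => [|T v pi u Hpi pi1] /=; first by rewrite Hl.
by rewrite (lP _ _ _ _ Hpi pi1) (mP _ _ _ _ Hpi pi1).
Qed.

Lemma leaf_definable_next p : leaf_definable (PX p).
Proof.
exists SFalse => // T v pi u _ pi1; rewrite ssat_SFalse /= pi1.
by split=> // -[].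
Qed.

(** With no later position, the until must be fulfilled immediately. *)
Lemma leaf_definable_until a b : is_hctl b -> leaf_definable (Until a b).
Proof.
move=> Hb; exists b => // T v pi u Hpi pi1; rewrite psat_Until1 psat_PState Hpi.1.
split=> [[[w [->]]//|[_]]|bv]; last by left; exists v.
rewrite psat_Until => -[j [lt_0j]]; rewrite psat_PState => -[w pij].
have : isSome (pi 1) by apply: is_path_Some Hpi lt_0j _; rewrite pij.
by rewrite pi1.
Qed.

(** * Boolean combinations and the translation *)

(** Normal forms of [psi] and of its negation are kept together, so that negation swaps them and no
    complement of a normal form is ever computed. *)
Definition boolean_definable psi : Prop :=
  [/\ leaf_definable psi, dnf_definable psi & dnf_definable (PNot psi)].

Lemma boolean_definable_eq p q :
  (forall (T : ltree AP) (pi : nat -> option T) i u,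
    psat q pi i u <-> psat p pi i u) ->
  boolean_definable p -> boolean_definable q.
Proof.
move=> pq [[l Hl lP] Dp Dn]; split.
- by exists l => // T v pi u Hpi pi1; rewrite pq; apply: lP Hpi pi1.
- by apply: dnf_definable_eq Dp => *; apply: pq.
- by apply: dnf_definable_eq Dn => T v pi u _ _ /=; rewrite pq.
Qed.

Lemma boolean_definable_not p :
  boolean_definable p -> boolean_definable (PNot p).
Proof.
move=> [Lp Dp Dn]; split=> //; first exact: leaf_definable_not.
apply: dnf_definable_eq Dp => T v pi u _ _ /=.
by split=> [/NNPP|]; auto.
Qed.

Lemma boolean_definable_or p q :
  boolean_definable p -> boolean_definable q -> boolean_definable (POr p q).
Proof.
move=> [Lp Dp Np] [Lq Dq Nq]; split.
- exact: leaf_definable_or.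
- exact: dnf_definable_or.
- apply: dnf_definable_eq (dnf_definable_and Np Nq) => T v pi u _ _ /=; tauto.
Qed.

Lemma boolean_definable_and p q :
  boolean_definable p -> boolean_definable q -> boolean_definable (PAnd p q).
Proof.
move=> [Lp Dp Np] [Lq Dq Nq]; split.
- exact: leaf_definable_and.
- exact: dnf_definable_and.
- apply: dnf_definable_eq (dnf_definable_or Np Nq) => T v pi u _ _ /=.
  by case: (classic (psat p pi 0 u)); tauto.
Qed.

Lemma psat_PState_equiv a b (T : ltree AP) (pi : nat -> option T) i u :
  sequiv a b -> psat (PState a) pi i u <-> psat (PState b) pi i u.
Proof. by move=> ab /=; case: (pi i). Qed.

Lemma hctl_plus_translation :
  (forall phi, is_hctl_plus phi ->
     exists2 phi', is_hctl phi' & sequiv phi phi') /\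
  (forall psi, is_hctl_plus_path psi -> boolean_definable psi).
Proof.
pose S phi := is_hctl_plus phi ->
  exists2 phi', is_hctl phi' & sequiv phi phi'.
(* A bare [PState a] is not an HCTL+ path formula, so the second conjunct is vacuous there; the
   first passes the hypothesis on [a] to the X and U cases. *)
pose Q psi := (if psi is PState a then S a else True) /\
  (is_hctl_plus_path psi -> boolean_definable psi).
suff [HS HQ] : (forall phi, S phi) /\ (forall psi, Q psi).
  by split=> // psi; case: (HQ psi).
apply: form_ind; rewrite /S /Q /=.
- by move=> p _; exists (SAtom k p).
- move=> a IHa /IHa[a' Ha E]; exists (SNot a') => // T v u /=.
  by rewrite (E T v u).
- move=> a IHa b IHb /andP[/IHa[a' Ha Ea] /IHb[b' Hb Eb]].
  exists (SOr a' b') => [|T v u] /=; first by rewrite Ha.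
  by rewrite (Ea T v u) (Eb T v u).
- move=> a IHa b IHb /andP[/IHa[a' Ha Ea] /IHb[b' Hb Eb]].
  exists (SAnd a' b') => [|T v u] /=; first by rewrite Ha.
  by rewrite (Ea T v u) (Eb T v u).
- by move=> psi [_ IH] /IH[Lp Dp _]; apply: SE_hctl.
- move=> psi [_ IH] /IH[Lp _ Dn].
  (* [A psi] is treated as [~ E ~psi], which uses the normal form of the negation. *)
  have [a Ha E] := SE_hctl (leaf_definable_not Lp) Dn.
  exists (SNot a) => // T v u; change (ssat (SNot a) v u) with (~ ssat a v u).
  rewrite -(E T v u) ssat_SE /=; split=> [Hall [pi Hpi]|nE pi Hpi].
    by apply; apply: Hall.
  by apply: NNPP => npsi; apply: nE; exists pi.
- move=> i a IHa /IHa[a' Ha E]; exists (SDown i a') => // T v u; exact: E.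
- by move=> i _; exists (SVar AP i).
- move=> i a IHa /IHa[a' Ha E]; exists (SAt i a') => // T v u; exact: E.
- by exists SRoot.
- move=> a IHa /IHa[a' Ha E]; exists (SAtRoot a') => // T v u; exact: E.
- by [].
- by move=> p [_ IHp]; split=> // /IHp; apply: boolean_definable_not.
- move=> p [_ IHp] q [_ IHq]; split=> // /andP[/IHp Dp /IHq Dq].
  exact: boolean_definable_or.
- move=> p [_ IHp] q [_ IHq]; split=> // /andP[/IHp Dp /IHq Dq].
  exact: boolean_definable_and.
- case=> // a [IHa _]; split=> // /IHa[a' Ha E].
  apply: (@boolean_definable_eq (PX (PState a'))) => [T pi i u|].
    by have := psat_PState_equiv pi i.+1 u E; rewrite /=; tauto.
  split; [exact: leaf_definable_next | exact: dnf_definable_next |].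
  exact: dnf_definable_not_next.
- case=> // a [IHa _] [] // b [IHb _]; split=> //.
  move=> /andP[/IHa[a' Ha Ea] /IHb[b' Hb Eb]].
  apply: (@boolean_definable_eq (Until a' b')) => [T pi i u|].
    rewrite -/(Until a b) !psat_Until; split=> -[j [le_ij bj al]]; exists j;
      split=> // [|l le_il lt_lj]; try exact/(psat_PState_equiv _ _ _ Eb);
      exact/(psat_PState_equiv _ _ _ Ea)/al.
  split; [exact: leaf_definable_until | exact: dnf_definable_until |].
  exact: dnf_definable_not_until.
Qed.

Lemma is_hctl_is_hctl_plus :
  (forall phi, is_hctl phi -> is_hctl_plus phi) /\
  (forall psi, is_hctl_path psi -> is_hctl_plus_path psi).
Proof.
pose S phi := is_hctl phi -> is_hctl_plus phi.
pose Q psi := (if psi is PState a then S a else True) /\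
  (is_hctl_path psi -> is_hctl_plus_path psi).
suff [HS HQ] : (forall phi, S phi) /\ (forall psi, Q psi).
  by split=> // psi; case: (HQ psi).
apply: form_ind; rewrite /S /Q //=.
- by move=> a IHa b IHb /andP[/IHa -> /IHb].
- by move=> a IHa b IHb /andP[/IHa -> /IHb].
- by move=> psi [].
- by move=> psi [].
- by case=> // a [].
- by case=> // a [IHa _] [] // b [IHb _]; split=> // /andP[/IHa -> /IHb].
Qed.

End Translation.

Theorem theorem1 (AP : Type) (k : nat) (hk : 1 <= k) :
  (forall phi : sform AP k, is_hctl_plus phi ->
     exists phi' : sform AP k, is_hctl phi' /\ sequiv phi phi') /\
  (forall phi : sform AP k, is_hctl phi -> is_hctl_plus phi).
Proof.
split; last exact: (is_hctl_is_hctl_plus AP k).1.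
by move=> phi /(hctl_plus_translation AP k).1[phi' Hphi' E]; exists phi'.
Qed.
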